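(* Let $\mathcal{G}$ be a groupoid and let $(\mathcal{N},p)$ be a group bundle over $\mathcal{G}^{(0)}$. The map $Z^2(\mathcal{G},\mathcal{N})\to \operatorname{Ext}(\mathcal{G},\mathcal{N})$ sending a factor system $(L,\sigma)$ to the equivalence class $[\mathcal{N}\times_{(L,\sigma)}\mathcal{G}]$ induces a bijection $$H^2(\mathcal{G},\mathcal{N}):=Z^2(\mathcal{G},\mathcal{N})/C^1(\mathcal{G},\mathcal{N})\;\longrightarrow\;\operatorname{Ext}(\mathcal{G},\mathcal{N}),$$ where the quotient is the orbit space of the action of the group $C^1(\mathcal{G},\mathcal{N})$ on $Z^2(\mathcal{G},\mathcal{N})$.
   Context: Groupoids are purely algebraic (no topology). A groupoid $\mathcal{G}$ has unit space $\mathcal{G}^{(0)}\subseteq\mathcal{G}$ and range and source maps $r,s:\mathcal{G}\to\mathcal{G}^{(0)}$; the product $xy$ is defined iff $s(x)=r(y)$; $\mathcal{G}^{(n)}$ is the set of $n$-tuples with $s(x_i)=r(x_{i+1})$. A groupoid homomorphism preserves products and inverses. A group bundle over $\mathcal{G}^{(0)}$ is a set $\mathcal{N}$ with a map $p:\mathcal{N}\to\mathcal{G}^{(0)}$ such that every fibre $N_u:=p^{-1}(u)$ is a group; identifying the identity $1_u$ of $N_u$ with $u$, $\mathcal{N}$ is a groupoid over $\mathcal{G}^{(0)}$ with $r=s=p$. Extensions. A groupoid extension of $\mathcal{G}$ by $\mathcal{N}$ is a surjective groupoid homomorphism $j:\mathcal{E}\to\mathcal{G}$, where $\mathcal{E}$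 is a groupoid with unit space $\mathcal{G}^{(0)}$, $j$ restricts to the identity on $\mathcal{G}^{(0)}$, and $\mathcal{N}=\ker(j):=\{e\in\mathcal{E}: j(e)\in\mathcal{G}^{(0)}\}$. Two extensions $j:\mathcal{E}\to\mathcal{G}$ and $j':\mathcal{E}'\to\mathcal{G}$ are equivalent if there is a groupoid homomorphism $\phi:\mathcal{E}\to\mathcal{E}'$ with $\phi|_{\mathcal{N}}=\mathrm{id}_{\mathcal{N}}$ and $j'\circ\phi=j$ (such $\phi$ is automatically an isomorphism). $\operatorname{Ext}(\mathcal{G},\mathcal{N})$ is the set of equivalence classes. Factor systems. $C^1(\mathcal{G},\operatorname{Iso}(\mathcal{N}))$ is the set of families of group isomorphisms $L_x:N_{s(x)}\to N_{r(x)}$, $x\in\mathcal{G}$, with $L_u=\mathrm{id}_{N_u}$ for $u\in\mathcal{G}^{(0)}$. $C^2(\mathcal{G},\mathcal{N})$ is the set of maps $\sigma:\mathcal{G}^{(2)}\to\mathcal{N}$ with $\sigma(x,y)\in N_{r(x)}$ and $\sigma(x,s(x))=\sigma(r(x),x)=r(x)$ (the identity of $N_{r(x)}$). A factor system for $(\mathcal{G},\mathcal{N})$ is a pair $(L,\sigma)$ of such data satisfying $L_xL_y(n)=\sigma(x,y)L_{xy}(n)\sigma(x,y)^{-1}$ for all $(x,y)\in\mathcal{G}^{(2)}$, $n\in N_{s(y)}$, and $\sigma(x,y)\sigma(xy,z)=L_x(\sigma(y,z))\sigma(x,yz)$ for all $(x,y,z)\in\mathcal{G}^{(3)}$. $Z^2(\mathcal{G},\mathcal{N})$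 is the set of factor systems. The extension $\mathcal{N}\times_{(L,\sigma)}\mathcal{G}$ is the set $\{(n,x)\in\mathcal{N}\times\mathcal{G}: p(n)=r(x)\}$ with source $s(n,x)=s(x)$, range $r(n,x)=r(x)$ (identifying $u\in\mathcal{G}^{(0)}$ with $(u,u)$), product $(n,x)(m,y)=(nL_x(m)\sigma(x,y),xy)$ and inverse $(n,x)^{-1}=(\sigma(x^{-1},x)^{-1}L_{x^{-1}}(n^{-1}),x^{-1})$; it is an extension via $j(n,x)=x$, with $\mathcal{N}$ identified with $\ker(j)$ through $n\mapsto(n,p(n))$. Action. $C^1(\mathcal{G},\mathcal{N})$ is the group (pointwise product) of maps $h:\mathcal{G}\to\mathcal{N}$ with $h(x)\in N_{r(x)}$ and $h(u)=u$ for $u\in\mathcal{G}^{(0)}$. It acts on $Z^2(\mathcal{G},\mathcal{N})$ by $h.(L,\sigma)=(h.L,h.\sigma)$, where $(h.L)_x(n)=h(x)L_x(n)h(x)^{-1}$ and $(h.\sigma)(x,y)=h(x)L_x(h(y))\sigma(x,y)h(xy)^{-1}$. *)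

(* Defs.v *)
From HB Require Import structures.
From mathcomp Require Import all_boot.
From mathcomp Require Import boolp.

Set Implicit Arguments.
Unset Strict Implicit.
Unset Printing Implicit Defensive.

Local Open Scope group_scope.

(* A groupoid with unit space [U], presented by its hom-sets: [G u v] is the  *)
(* set of arrows x with r(x) = u and s(x) = v.  Thus [gcomp x y] is typable   *)
(* exactly when s(x) = r(y), n-tuples of composable arrows are chains         *)
(* x_1 : G u_0 u_1, x_2 : G u_1 u_2, and so on, and a unit u, seen as an      *)
(* arrow, is [gid G u].                                                       *)
Record groupoid (U : Type) := Groupoid {
  arrow :> U -> U -> Type;
  gid : forall u, arrow u u;
  gcomp : forall u v w, arrow u v -> arrow v w -> arrow u w;
  ginv : forall u v, arrow u v -> arrow v u;
  gcompA : forall u v w t (x : arrow u v) (y : arrow v w) (z : arrow w t),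
    gcomp x (gcomp y z) = gcomp (gcomp x y) z;
  gcomp1l : forall u v (x : arrow u v), gcomp (gid u) x = x;
  gcomp1r : forall u v (x : arrow u v), gcomp x (gid v) = x;
  gcompVl : forall u v (x : arrow u v), gcomp (ginv x) x = gid v;
  gcompVr : forall u v (x : arrow u v), gcomp x (ginv x) = gid u }.

Arguments gid {U} G u : rename.
Arguments gcomp {U G u v w} x y : rename.
Arguments ginv {U G u v} x : rename.

Notation "x ** y" := (gcomp x y) (at level 40, left associativity).

(* Homomorphisms between groupoids over the same unit space that fix every    *)
(* unit, hence commute with r and s.  The maps j of extensions are such; so   *)
(* are the maps phi of equivalences, since j' phi = j.                        *)
Record groupoid_hom (U : Type) (G H : groupoid U) := GroupoidHom {
  hom_fun : forall u v, G u v -> H u v;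
  hom_comp : forall u v w (x : G u v) (y : G v w),
    hom_fun (x ** y) = hom_fun x ** hom_fun y;
  hom_inv : forall u v (x : G u v), hom_fun (ginv x) = ginv (hom_fun x) }.

Arguments hom_fun {U G H} g {u v} x : rename.

(* [N u] is the fibre p^-1(u) of the bundle.  The groups are arbitrary: the   *)
(* choice operator carried by a [groupType] exists classically on any type.   *)
Definition group_bundle (U : Type) := U -> groupType.

Section Extensions.
Variables (U : Type) (G : groupoid U) (N : group_bundle U).

(* [ext_incl] is the identification of N with ker(j).  An arrow e : E u v     *)
(* with j(e) a unit has u = v, so ker(j) lies in the isotropy sets [E u u].   *)
Record extension := Extension {
  ext_gpd : groupoid U;
  ext_proj : groupoid_hom ext_gpd G;
  ext_incl : forall u, N u -> ext_gpd u u;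
  ext_proj_id : forall u, hom_fun ext_proj (gid ext_gpd u) = gid G u;
  ext_proj_surj : forall u v (x : G u v), exists e, hom_fun ext_proj e = x;
  ext_inclM : forall u (n m : N u),
    ext_incl (n * m) = ext_incl n ** ext_incl m;
  ext_incl_inj : forall u, injective (@ext_incl u);
  ext_kerP : forall u (e : ext_gpd u u),
    hom_fun ext_proj e = gid G u <-> exists n, e = ext_incl n }.

(* An equivalence relation, since every such phi is bijective. *)
Definition ext_equiv (E E' : extension) : Prop :=
  exists phi : groupoid_hom (ext_gpd E) (ext_gpd E'),
    (forall u (n : N u), hom_fun phi (ext_incl E n) = ext_incl E' n) /\
    (forall u v (e : ext_gpd E u v),
       hom_fun (ext_proj E') (hom_fun phi e) = hom_fun (ext_proj E) e).

(* The set of equivalence classes, each class being a predicate. *)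
Definition Ext : Type :=
  {C : extension -> Prop | exists E, C = ext_equiv E}.

Definition Ext_class (E : extension) : Ext :=
  exist _ (ext_equiv E) (ex_intro _ E erefl).

Record C1Iso := C1IsoBuild {
  isoL : forall u v, G u v -> N v -> N u;
  isoLM : forall u v (x : G u v), {morph isoL x : n m / n * m};
  isoL_bij : forall u v (x : G u v), bijective (isoL x);
  isoL_id : forall u (n : N u), isoL (gid G u) n = n }.

Record C2 := C2Build {
  cochain2 : forall u v w, G u v -> G v w -> N u;
  cochain2_idr : forall u v (x : G u v), cochain2 x (gid G v) = 1;
  cochain2_idl : forall u v (x : G u v), cochain2 (gid G u) x = 1 }.

Record C1 := C1Build {
  cochain1 : forall u v, G u v -> N u;
  cochain1_id : forall u, cochain1 (gid G u) = 1 }.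

End Extensions.

Arguments isoL {U G N} c {u v} x n : rename.
Arguments cochain2 {U G N} c {u v w} x y : rename.
Arguments cochain1 {U G N} c {u v} x : rename.

Section FactorSystems.
#[local] Obligation Tactic := idtac.
Variables (U : Type) (G : groupoid U) (N : group_bundle U).

Record Z2 := FactorSystem {
  fsL : C1Iso G N;
  fsS : C2 G N;
  fs_twist : forall u v w (x : G u v) (y : G v w) (n : N w),
    isoL fsL x (isoL fsL y n) =
      cochain2 fsS x y * isoL fsL (x ** y) n * (cochain2 fsS x y)^-1;
  fs_cocycle : forall u v w t (x : G u v) (y : G v w) (z : G w t),
    cochain2 fsS x y * cochain2 fsS (x ** y) z =
      isoL fsL x (cochain2 fsS y z) * cochain2 fsS x (y ** z) }.

Lemma isoL1 (L : C1Iso G N) u v (x : G u v) : isoL L x 1 = 1.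
Proof. by apply: (mulgI (isoL L x 1)); rewrite -isoLM !mulg1. Qed.

Lemma isoLV (L : C1Iso G N) u v (x : G u v) n : isoL L x n^-1 = (isoL L x n)^-1.
Proof. by apply: (mulgI (isoL L x n)); rewrite -isoLM !mulgV isoL1. Qed.

Lemma C1Iso_eq (L L' : C1Iso G N) :
  (forall u v (x : G u v) n, isoL L x n = isoL L' x n) -> L = L'.
Proof.
case: L L' => [L LM Lb L1] [L' LM' Lb' L1'] /= e.
have {}e : L = L'.
  by do 3 (apply: functional_extensionality_dep => ?); apply/funext.
subst L'; congr C1IsoBuild; exact: Prop_irrelevance.
Qed.

Lemma C2_eq (s s' : C2 G N) :
  (forall u v w (x : G u v) (y : G v w), cochain2 s x y = cochain2 s' x y) ->
  s = s'.
Proof.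
case: s s' => [s sr sl] [s' sr' sl'] /= e.
have {}e : s = s' by do 5 (apply: functional_extensionality_dep => ?).
subst s'; congr C2Build; exact: Prop_irrelevance.
Qed.

Lemma C1_eq (h h' : C1 G N) :
  (forall u v (x : G u v), cochain1 h x = cochain1 h' x) -> h = h'.
Proof.
case: h h' => [h h1] [h' h1'] /= e.
have {}e : h = h' by do 3 (apply: functional_extensionality_dep => ?).
subst h'; congr C1Build; exact: Prop_irrelevance.
Qed.

Lemma Z2_eq (z z' : Z2) : fsL z = fsL z' -> fsS z = fsS z' -> z = z'.
Proof.
case: z z' => [L s t c] [L' s' t' c'] /= eL es; subst L' s'.
congr FactorSystem; exact: Prop_irrelevance.
Qed.

Definition c1_one : C1 G N :=
  @C1Build U G N (fun u v _ => 1) (fun u => erefl).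

Program Definition c1_mul (h k : C1 G N) : C1 G N :=
  @C1Build U G N (fun u v x => cochain1 h x * cochain1 k x) _.
Next Obligation. by move=> h k u /=; rewrite !cochain1_id mulg1. Qed.

Program Definition c1_inv (h : C1 G N) : C1 G N :=
  @C1Build U G N (fun u v x => (cochain1 h x)^-1) _.
Next Obligation. by move=> h u /=; rewrite cochain1_id invg1. Qed.

Lemma c1_mulA : associative c1_mul.
Proof. by move=> h k l; apply: C1_eq => u v x /=; rewrite mulgA. Qed.
Lemma c1_mul1g : left_id c1_one c1_mul.
Proof. by move=> h; apply: C1_eq => u v x /=; rewrite mul1g. Qed.
Lemma c1_mulg1 : right_id c1_one c1_mul.
Proof. by move=> h; apply: C1_eq => u v x /=; rewrite mulg1. Qed.
Lemma c1_mulVg : left_inverse c1_one c1_inv c1_mul.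
Proof. by move=> h; apply: C1_eq => u v x /=; rewrite mulVg. Qed.
Lemma c1_mulgV : right_inverse c1_one c1_inv c1_mul.
Proof. by move=> h; apply: C1_eq => u v x /=; rewrite mulgV. Qed.

HB.instance Definition _ := gen_eqMixin (C1 G N).
HB.instance Definition _ := gen_choiceMixin (C1 G N).
HB.instance Definition _ := isGroup.Build (C1 G N)
  c1_mulA c1_mul1g c1_mulg1 c1_mulVg c1_mulgV.

Program Definition act_L (h : C1 G N) (L : C1Iso G N) : C1Iso G N :=
  @C1IsoBuild U G N
    (fun u v x n => cochain1 h x * isoL L x n * (cochain1 h x)^-1) _ _ _.
Next Obligation.
by move=> h L u v x n m /=; rewrite isoLM !mulgA mulgVK.
Qed.
Next Obligation.
move=> h L u v x; have [K LK KL] := isoL_bij L x.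
exists (fun n => K ((cochain1 h x)^-1 * n * cochain1 h x)) => n.
  by rewrite !mulgA mulVg mul1g mulgVK LK.
by rewrite KL !mulgA mulgV mul1g mulgK.
Qed.
Next Obligation.
by move=> h L u n /=; rewrite cochain1_id isoL_id mul1g invg1 mulg1.
Qed.

Program Definition act_S (h : C1 G N) (L : C1Iso G N) (s : C2 G N) : C2 G N :=
  @C2Build U G N
    (fun u v w x y => cochain1 h x * isoL L x (cochain1 h y) * cochain2 s x y
                      * (cochain1 h (x ** y))^-1) _ _.
Next Obligation.
move=> h L s u v x /=.
by rewrite cochain1_id isoL1 cochain2_idr gcomp1r !mulg1 mulgV.
Qed.
Next Obligation.
move=> h L s u v x /=.
by rewrite cochain1_id isoL_id cochain2_idl gcomp1l mul1g mulg1 mulgV.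
Qed.

Program Definition act (h : C1 G N) (z : Z2) : Z2 :=
  @FactorSystem (act_L h (fsL z)) (act_S h (fsL z) (fsS z)) _ _.
Next Obligation.
move=> h z u v w x y n /=.
rewrite !isoLM !isoLV fs_twist !invgM !invgK !mulgA.
by rewrite !(mulgVK, mulgK).
Qed.
Next Obligation.
move=> h z u v w t x y z' /=.
rewrite !isoLM !isoLV fs_twist !mulgA.
rewrite !(mulgVK, mulgK) gcompA; congr (_ * _).
by rewrite -!mulgA -fs_cocycle mulKg.
Qed.

Lemma act1 (z : Z2) : act 1 z = z.
Proof.
apply: Z2_eq.
  by apply: C1Iso_eq => u v x n /=; rewrite mul1g invg1 mulg1.
apply: C2_eq => u v w x y /=.
by rewrite isoL1 !mul1g invg1 mulg1.
Qed.

Lemma actM (h k : C1 G N) (z : Z2) : act (h * k) z = act h (act k z).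
Proof.
apply: Z2_eq.
  by apply: C1Iso_eq => u v x n /=; rewrite invgM !mulgA.
apply: C2_eq => u v w x y /=.
by rewrite invgM isoLM !mulgA !mulgVK.
Qed.

Definition c1_orbit (z z' : Z2) : Prop := exists h : C1 G N, z' = act h z.

Definition H2 : Type := {O : Z2 -> Prop | exists z, O = c1_orbit z}.

Definition H2_class (z : Z2) : H2 :=
  exist _ (c1_orbit z) (ex_intro _ z erefl).

Section CrossedProduct.
Variable z : Z2.
Let L := fsL z.
Let S := fsS z.

(* {(n, x) | p(n) = r(x)} *)
Definition cp_arrow (u v : U) : Type := (N u * G u v)%type.

Definition cp_id (u : U) : cp_arrow u u := (1, gid G u).

Definition cp_comp u v w (a : cp_arrow u v) (b : cp_arrow v w) : cp_arrow u w :=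
  (a.1 * isoL L a.2 b.1 * cochain2 S a.2 b.2, a.2 ** b.2).

Definition cp_inv u v (a : cp_arrow u v) : cp_arrow v u :=
  ((cochain2 S (ginv a.2) a.2)^-1 * isoL L (ginv a.2) (a.1)^-1, ginv a.2).

Lemma cp_compA u v w t (a : cp_arrow u v) (b : cp_arrow v w)
    (c : cp_arrow w t) :
  cp_comp a (cp_comp b c) = cp_comp (cp_comp a b) c.
Proof.
case: a b c => [n x] [m y] [k y'].
rewrite /cp_comp /= gcompA; congr (_, _).
by rewrite !isoLM fs_twist -!mulgA -/S; do 4 congr (_ * _);
   rewrite -fs_cocycle !mulgA mulVg mul1g.
Qed.

Lemma cp_comp1l u v (a : cp_arrow u v) : cp_comp (cp_id u) a = a.
Proof.
by case: a => n x; rewrite /cp_comp /= isoL_id cochain2_idl gcomp1l mul1g mulg1.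
Qed.

Lemma cp_comp1r u v (a : cp_arrow u v) : cp_comp a (cp_id v) = a.
Proof.
by case: a => n x; rewrite /cp_comp /= isoL1 cochain2_idr gcomp1r !mulg1.
Qed.

Lemma cp_compVl u v (a : cp_arrow u v) : cp_comp (cp_inv a) a = cp_id v.
Proof.
case: a => n x; rewrite /cp_comp /cp_inv /cp_id /= gcompVl; congr (_, _).
by rewrite isoLV mulgVK mulVg.
Qed.

Lemma cp_compVr u v (a : cp_arrow u v) : cp_comp a (cp_inv a) = cp_id u.
Proof.
case: a => n x; rewrite /cp_comp /cp_inv /cp_id /= gcompVr; congr (_, _).
have := fs_cocycle z x (ginv x) x.
rewrite gcompVl gcompVr cochain2_idl cochain2_idr !mulg1 => e.
rewrite isoLM isoLV -e fs_twist gcompVr isoL_id !mulgA.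
by rewrite mulgVK mulgVK mulgV.
Qed.

Definition cp_groupoid : groupoid U :=
  @Groupoid U cp_arrow cp_id cp_comp cp_inv
    cp_compA cp_comp1l cp_comp1r cp_compVl cp_compVr.

Definition cp_proj : groupoid_hom cp_groupoid G :=
  @GroupoidHom U cp_groupoid G (fun u v a => a.2)
    (fun u v w a b => erefl) (fun u v a => erefl).

Definition cp_incl u (n : N u) : cp_groupoid u u := (n, gid G u).

Program Definition crossed_product : extension G N :=
  @Extension U G N cp_groupoid cp_proj cp_incl _ _ _ _ _.
Next Obligation. by []. Qed.
Next Obligation. by move=> u v x; exists (1, x). Qed.
Next Obligation.
move=> u n m; rewrite /cp_incl /= /cp_comp /=.
by rewrite isoL_id cochain2_idl gcomp1l mulg1.
Qed.
Next Obligation. by move=> u n m []. Qed.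
Next Obligation.
move=> u [n x] /=; split=> [->|[m []] //]; by exists n.
Qed.

End CrossedProduct.

End FactorSystems.

(* Main.v *)
Require Import Defs.
From mathcomp Require Import all_boot.
From mathcomp Require Import boolp.

(** The idea is Schreier's: a factor system is what one reads off an extension
    [E] once a set-theoretic section [k] of [j : E -> G] has been chosen.
    Conjugation by [k x] on the kernel gives [L_x], and the failure of [k] to be
    multiplicative gives sigma.  The relation [presents E k z] says that [z]
    arises from [k] in this way, and everything follows from four facts about it.

    - The crossed product of [z] is equivalent to [E] if and only if some section
      of [E] presents [z] ([presents_equiv], [equiv_presents]): an equivalence is
      determined by the images of the arrows [(1, x)], and these images form a
      section.
    - Every extension has a section presenting some factor system
      ([presents_exists]), so the map to Ext is surjective.
    - Two sections of [E] differ by a 1-cochain [h], and moving the section by [h]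
      moves the factor system by the action of [h] ([presents_act],
      [presents_orbit]), so the fibres of the map to Ext are exactly the orbits.
    - A section presents at most one factor system ([presents_inj]).

    The relation of equivalence of extensions is symmetric because an equivalence
    is bijective on arrows, by the short five lemma. *)

Set Implicit Arguments.
Unset Strict Implicit.
Unset Printing Implicit Defensive.

Local Open Scope group_scope.

(** * Cancellation in groupoids and homomorphisms *)

Section GroupoidTheory.
Variables (U : Type) (G : groupoid U).

Lemma gcompKV u v w (x : G u v) (y : G w v) : x ** ginv y ** y = x.
Proof. by rewrite -gcompA gcompVl gcomp1r. Qed.

Lemma gcompK u v w (x : G u v) (y : G v w) : x ** y ** ginv y = x.
Proof. by rewrite -gcompA gcompVr gcomp1r. Qed.

Lemma gcompIr u v w (y : G v w) : injective (fun x : G u v => x ** y).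
Proof. by move=> x x' /(congr1 (fun a => a ** ginv y)); rewrite !gcompK. Qed.

Lemma ginv_unique u v (x : G u v) (y : G v u) : y ** x = gid G v -> y = ginv x.
Proof. by move=> e; apply: (@gcompIr _ _ _ x); rewrite e gcompVl. Qed.

Lemma gidem_id u (x : G u u) : x ** x = x -> x = gid G u.
Proof. by move=> e; apply: (@gcompIr _ _ _ x); rewrite e gcomp1l. Qed.

End GroupoidTheory.

Section Homs.
Variables (U : Type) (G H : groupoid U).

Lemma mul_inv (f : forall u v, G u v -> H u v) :
  (forall u v w (x : G u v) (y : G v w), f _ _ (x ** y) = f _ _ x ** f _ _ y) ->
  forall u v (x : G u v), f _ _ (ginv x) = ginv (f _ _ x).
Proof.
move=> fM u v x; apply: ginv_unique; rewrite -fM gcompVl.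
by apply: gidem_id; rewrite -fM gcomp1l.
Qed.

Definition hom_of_mul (f : forall u v, G u v -> H u v)
  (fM : forall u v w (x : G u v) (y : G v w),
    f _ _ (x ** y) = f _ _ x ** f _ _ y) : groupoid_hom G H :=
  GroupoidHom fM (mul_inv fM).

End Homs.

(** * Fibres of an extension *)

Section Extension.
Variables (U : Type) (G : groupoid U) (N : group_bundle U).
Implicit Types E : extension G N.

Lemma ext_incl1 E u : ext_incl E (1 : N u) = gid (ext_gpd E) u.
Proof. by apply: gidem_id; rewrite -ext_inclM mulg1. Qed.

Lemma ext_proj_incl E u (n : N u) :
  hom_fun (ext_proj E) (ext_incl E n) = gid G u.
Proof. by apply/ext_kerP; exists n. Qed.

Lemma ext_proj_inclM E u v (n : N u) (e : ext_gpd E u v) :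
  hom_fun (ext_proj E) (ext_incl E n ** e) = hom_fun (ext_proj E) e.
Proof. by rewrite hom_comp ext_proj_incl gcomp1l. Qed.

(** Together with [ext_incl_actI]: N acts simply transitively on each fibre
    of [j]; it is the source of the existence and uniqueness of [L], of sigma and
    of the cochain relating two sections. *)
Lemma ext_fibre E u v (e e' : ext_gpd E u v) :
  hom_fun (ext_proj E) e = hom_fun (ext_proj E) e' ->
  exists n : N u, e = ext_incl E n ** e'.
Proof.
move=> eq_j.
have /ext_kerP[n en] : hom_fun (ext_proj E) (e ** ginv e') = gid G u.
  by rewrite hom_comp hom_inv eq_j gcompVr.
by exists n; rewrite -en gcompKV.
Qed.

Lemma ext_incl_actI E u v (e : ext_gpd E u v) :
  injective (fun n : N u => ext_incl E n ** e).
Proof. by move=> n m eq_nm; apply: (@ext_incl_inj _ _ _ E); apply: gcompIr eq_nm. Qed.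

(** * Equivalence of extensions *)

Lemma ext_equiv_refl E : ext_equiv E E.
Proof.
by exists (@GroupoidHom _ _ _ (fun u v e => e) (fun _ _ _ _ _ => erefl)
  (fun _ _ _ => erefl)).
Qed.

Lemma ext_equiv_trans E E' E'' :
  ext_equiv E E' -> ext_equiv E' E'' -> ext_equiv E E''.
Proof.
move=> [f [fN fj]] [g [gN gj]].
have gfM u v w (x : ext_gpd E u v) (y : ext_gpd E v w) :
    hom_fun g (hom_fun f (x ** y)) =
    hom_fun g (hom_fun f x) ** hom_fun g (hom_fun f y).
  by rewrite !hom_comp.
exists (hom_of_mul gfM); split=> [u n|u v e] /=.
  by rewrite fN gN.
by rewrite gj fj.
Qed.

(** The short five lemma: both fibres over [x] are torsors under the same group,
    and the map between them is equivariant. *)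
Lemma ext_equiv_sym E E' : ext_equiv E E' -> ext_equiv E' E.
Proof.
move=> [f [fN fj]].
have f_inj u v : injective (fun e : ext_gpd E u v => hom_fun f e).
  move=> e e' ff.
  have [|n en] := @ext_fibre E u v e e'; first by rewrite -!fj ff.
  suff n1 : n = 1 by rewrite en n1 ext_incl1 gcomp1l.
  apply: (@ext_incl_actI E' _ _ (hom_fun f e')).
  by rewrite -{1}fN -hom_comp -en ff ext_incl1 gcomp1l.
have f_surj u v (e' : ext_gpd E' u v) : exists e, hom_fun f e = e'.
  have [e je] := ext_proj_surj E (hom_fun (ext_proj E') e').
  have [|n ->] := @ext_fibre E' u v e' (hom_fun f e); first by rewrite fj je.
  by exists (ext_incl E n ** e); rewrite hom_comp fN.
pose g u v (e' : ext_gpd E' u v) := sval (cid (f_surj u v e')).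
have fg u v (e' : ext_gpd E' u v) : hom_fun f (g u v e') = e'.
  by rewrite /g; case: cid.
have gM u v w (x : ext_gpd E' u v) (y : ext_gpd E' v w) :
    g _ _ (x ** y) = g _ _ x ** g _ _ y.
  by apply: f_inj; rewrite /= hom_comp !fg.
exists (hom_of_mul gM); split=> [u n|u v e] /=.
  by apply: f_inj; rewrite /= fg fN.
by rewrite -fj fg.
Qed.

Lemma Ext_classP E E' : Ext_class E = Ext_class E' <-> ext_equiv E E'.
Proof.
split=> [/(congr1 sval) /= ->|eqE]; first exact: ext_equiv_refl.
apply: eq_exist => /=; apply/funext => F; apply/propext; split.
  exact/ext_equiv_trans/ext_equiv_sym.
exact: ext_equiv_trans.
Qed.

(** * Orbits of factor systems *)

Lemma c1_orbit_refl (z : Z2 G N) : c1_orbit z z.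
Proof. by exists 1; rewrite act1. Qed.

Lemma H2_classP (z z' : Z2 G N) :
  H2_class z = H2_class z' <-> exists h, z' = act h z.
Proof.
split=> [/(congr1 sval) /= e|[h ->]].
  by change (c1_orbit z z'); rewrite e; exact: c1_orbit_refl.
apply: eq_exist => /=; apply/funext => y; apply/propext; split=> -[k ->].
  by exists (k * h^-1); rewrite -actM mulgVK.
by exists (k * h); rewrite actM.
Qed.

(** * Sections and the factor systems they present *)

Record presents E (k : forall u v, G u v -> ext_gpd E u v) (z : Z2 G N) :
    Prop := Presents {
  presents_proj : forall u v (x : G u v), hom_fun (ext_proj E) (k u v x) = x;
  presents_L : forall u v (x : G u v) (n : N v),
    k u v x ** ext_incl E n = ext_incl E (isoL (fsL z) x n) ** k u v x;
  presents_S : forall u v w (x : G u v) (y : G v w),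
    k u v x ** k v w y =
      ext_incl E (cochain2 (fsS z) x y) ** k u w (x ** y) }.
Arguments presents : clear implicits.

(** Sections are not asked to be unital: this follows, because sigma is
    normalised and so [k u] is idempotent. *)
Lemma presents_id E k z u : presents E k z -> k u u (gid G u) = gid _ u.
Proof.
move=> p; apply: gidem_id.
by rewrite (presents_S p) cochain2_idl ext_incl1 !gcomp1l.
Qed.

Lemma presents_inj E k z z' : presents E k z -> presents E k z' -> z = z'.
Proof.
move=> p p'; apply: Z2_eq.
  apply: C1Iso_eq => u v x n; apply: (@ext_incl_actI E _ _ (k u v x)).
  by rewrite /= -(presents_L p) -(presents_L p').
apply: C2_eq => u v w x y; apply: (@ext_incl_actI E _ _ (k u w (x ** y))).
by rewrite /= -(presents_S p) -(presents_S p').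
Qed.

Lemma presents_crossed_product (z : Z2 G N) :
  presents (crossed_product z) (fun u v x => (1, x)) z.
Proof.
split=> [//|u v x n|u v w x y]; rewrite /= /cp_incl /cp_comp /=.
  by rewrite !cochain2_idr !cochain2_idl isoL1 gcomp1r gcomp1l !mul1g !mulg1.
by rewrite !isoL1 gcomp1l cochain2_idl !mul1g !mulg1.
Qed.

(** An equivalence carries a section to a section and fixes N, hence preserves
    the presented factor system. *)
Lemma equiv_presents E (z : Z2 G N) :
  ext_equiv (crossed_product z) E -> exists k, presents E k z.
Proof.
move=> [f [fN fj]]; have p := presents_crossed_product z.
exists (fun u v x => hom_fun f ((1, x) : ext_gpd (crossed_product z) u v)).
split=> [u v x|u v x n|u v w x y].
- by rewrite fj (presents_proj p).
- by rewrite -!fN -!hom_comp (presents_L p).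
- by rewrite -!fN -!hom_comp (presents_S p).
Qed.

(** The product on pairs is designed so that [(n, x)] stands for [n k(x)]:
    in E, n k(x) m k(y) = n L_x(m) k(x) k(y) = n L_x(m) sigma(x, y) k(xy). *)
Lemma presents_equiv E k (z : Z2 G N) :
  presents E k z -> ext_equiv (crossed_product z) E.
Proof.
move=> p.
pose f u v (a : ext_gpd (crossed_product z) u v) := ext_incl E a.1 ** k u v a.2.
have fM u v w (a : ext_gpd (crossed_product z) u v)
    (b : ext_gpd (crossed_product z) v w) :
    f _ _ (a ** b) = f _ _ a ** f _ _ b.
  rewrite /f /= !ext_inclM -!gcompA -(presents_S p); congr (_ ** _).
  by rewrite !gcompA (presents_L p).
exists (hom_of_mul fM); split=> [u n|u v e]; rewrite /= /f /=.
  by rewrite (presents_id _ p) gcomp1r.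
by rewrite ext_proj_inclM (presents_proj p).
Qed.

Lemma presents_act E k (z : Z2 G N) (h : C1 G N) :
  presents E k z ->
  presents E (fun u v x => ext_incl E (cochain1 h x) ** k u v x) (act h z).
Proof.
move=> p; split=> [u v x|u v x n|u v w x y].
- by rewrite ext_proj_inclM (presents_proj p).
- by rewrite -gcompA (presents_L p) !gcompA -!ext_inclM /= mulgVK.
- rewrite -gcompA (gcompA (k _ _ x)) (presents_L p) -gcompA (presents_S p).
  by rewrite !gcompA -!ext_inclM /= mulgVK.
Qed.

Lemma presents_orbit E k k' (z z' : Z2 G N) :
  presents E k z -> presents E k' z' -> exists h, z' = act h z.
Proof.
move=> p p'.
have d u v (x : G u v) : exists n : N u, k' u v x = ext_incl E n ** k u v x.
  by apply: ext_fibre; rewrite (presents_proj p) (presents_proj p').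
pose h u v (x : G u v) := sval (cid (d u v x)).
have hE u v (x : G u v) : k' u v x = ext_incl E (h u v x) ** k u v x.
  by rewrite /h; case: cid.
have h1 u : h u u (gid G u) = 1.
  apply: (@ext_incl_actI E _ _ (k u u (gid G u))).
  by rewrite /= -hE (presents_id _ p) (presents_id _ p') ext_incl1 gcomp1l.
exists (C1Build h1); apply: presents_inj p' _.
have -> : k' = fun u v x => ext_incl E (cochain1 (C1Build h1) x) ** k u v x.
  by do 3 apply: functional_extensionality_dep => ?; apply: hE.
exact: presents_act.
Qed.

Lemma section_exists E : exists k : forall u v, G u v -> ext_gpd E u v,
  (forall u v (x : G u v), hom_fun (ext_proj E) (k u v x) = x) /\
  forall u, k u u (gid G u) = gid _ u.
Proof.
pose k u v (x : G u v) := sval (cid (ext_proj_surj E x)).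
have jk u v (x : G u v) : hom_fun (ext_proj E) (k u v x) = x.
  by rewrite /k; case: cid.
(* Translating by the inverse of the value at the range makes the section
   unital without deciding which arrows are units. *)
exists (fun u v x => ginv (k u u (gid G u)) ** k u v x).
split=> [u v x|u]; last by rewrite gcompVl.
rewrite hom_comp hom_inv !jk; apply: (@gcompIr _ _ _ _ _ (ginv x)).
by rewrite gcompK gcompVr -[LHS]gcomp1r gcompVl.
Qed.

(** Conjugation by [k x] and the defect of multiplicativity of [k] form a factor
    system: both identities compare two ways of moving everything to the left of
    one value of [k], by associativity in [E]. *)
Lemma presents_exists E : exists k z, presents E k z.
Proof.
have [k [jk k1]] := section_exists E.
have dL u v (x : G u v) (n : N v) : exists m : N u,
    k u v x ** ext_incl E n = ext_incl E m ** k u v x.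
  by apply: ext_fibre; rewrite hom_comp ext_proj_incl gcomp1r.
have dS u v w (x : G u v) (y : G v w) : exists m : N u,
    k u v x ** k v w y = ext_incl E m ** k u w (x ** y).
  by apply: ext_fibre; rewrite hom_comp !jk.
pose L u v (x : G u v) n := sval (cid (dL u v x n)).
pose S u v w (x : G u v) (y : G v w) := sval (cid (dS u v w x y)).
have LE u v (x : G u v) n :
    k u v x ** ext_incl E n = ext_incl E (L u v x n) ** k u v x.
  by rewrite /L; case: cid.
have SE u v w (x : G u v) (y : G v w) :
    k u v x ** k v w y = ext_incl E (S u v w x y) ** k u w (x ** y).
  by rewrite /S; case: cid.
have LM u v (x : G u v) : {morph L u v x : n m / n * m}.
  move=> n m; apply: (@ext_incl_actI E _ _ (k u v x)).
  by rewrite /= -LE !ext_inclM gcompA LE -gcompA LE gcompA.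
have Lbij u v (x : G u v) : bijective (L u v x).
  have dK (n : N u) : exists m : N v,
      ext_incl E m = ginv (k u v x) ** ext_incl E n ** k u v x.
    have /ext_kerP[m ->] : hom_fun (ext_proj E)
        (ginv (k u v x) ** ext_incl E n ** k u v x) = gid G v.
      by rewrite !hom_comp hom_inv ext_proj_incl gcomp1r gcompVl.
    by exists m.
  exists (fun n => sval (cid (dK n))) => n; case: cid => m /= em.
    by apply: (@ext_incl_inj _ _ _ E); rewrite em -gcompA -LE gcompA gcompVl gcomp1l.
  apply: (@ext_incl_actI E _ _ (k u v x)).
  by rewrite /= -LE em !gcompA gcompVr gcomp1l.
have L1 u (n : N u) : L u u (gid G u) n = n.
  apply: (@ext_incl_actI E _ _ (k u u (gid G u))).
  by rewrite /= -LE k1 gcomp1l gcomp1r.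
have Sr u v (x : G u v) : S u v v x (gid G v) = 1.
  apply: (@ext_incl_actI E _ _ (k u v (x ** gid G v))).
  by rewrite /= -SE k1 ext_incl1 gcomp1l gcomp1r gcomp1r.
have Sl u v (x : G u v) : S u u v (gid G u) x = 1.
  apply: (@ext_incl_actI E _ _ (k u v (gid G u ** x))).
  by rewrite /= -SE k1 ext_incl1 !gcomp1l.
have tw u v w (x : G u v) (y : G v w) (n : N w) :
    L u v x (L v w y n) =
    S u v w x y * L u w (x ** y) n * (S u v w x y)^-1.
  apply: (mulIg (S u v w x y)); rewrite mulgVK.
  apply: (@ext_incl_actI E _ _ (k u w (x ** y))).
  rewrite /= !ext_inclM -!gcompA -SE -LE !gcompA -LE -SE.
  by rewrite -!gcompA LE.
have co u v w t (x : G u v) (y : G v w) (z : G w t) :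
    S u v w x y * S u w t (x ** y) z =
    L u v x (S v w t y z) * S u v t x (y ** z).
  apply: (@ext_incl_actI E _ _ (k u t (x ** (y ** z)))).
  rewrite /= !ext_inclM -!gcompA -SE (gcompA x) -SE !gcompA -SE -LE.
  by rewrite -!gcompA -SE.
exists k, (@FactorSystem _ _ _ (C1IsoBuild LM Lbij L1) (C2Build Sr Sl) tw co).
by split.
Qed.

(** * The classification *)

Lemma crossed_product_equivP (z z' : Z2 G N) :
  ext_equiv (crossed_product z) (crossed_product z') <->
  exists h, z' = act h z.
Proof.
have p := presents_crossed_product; split=> [/equiv_presents[k pk]|[h ->]].
  exact: presents_orbit pk (p z').
exact/ext_equiv_sym/presents_equiv/presents_act.
Qed.

End Extension.

Theorem corollary3p17 (U : Type) (G : groupoid U) (N : group_bundle U) :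
  exists f : H2 G N -> Ext G N,
    (forall z : Z2 G N, f (H2_class z) = Ext_class (crossed_product z)) /\
    bijective f.
Proof.
have H2E (C : H2 G N) : exists z, C = H2_class z.
  by case: C => C [z e]; exists z; apply: eq_exist.
have ExtE (C : Ext G N) : exists z : Z2 G N, C = Ext_class (crossed_product z).
  case: C => C [E e]; have [k [z /presents_equiv/Ext_classP zE]] :=
    presents_exists E.
  by exists z; rewrite zE; apply: eq_exist.
have clP (z z' : Z2 G N) : H2_class z = H2_class z' <->
    Ext_class (crossed_product z) = Ext_class (crossed_product z').
  exact: (iff_trans (H2_classP z z') (iff_sym (iff_trans (Ext_classP _ _)
    (crossed_product_equivP z z')))).
exists (fun C => Ext_class (crossed_product (sval (cid (H2E C))))).
split=> [z|]; first by case: cid => z' /= /clP.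
exists (fun C => H2_class (sval (cid (ExtE C)))) => C.
  by case: (cid (H2E C)) => z /= ->; case: cid => z' /= /clP.
by case: (cid (ExtE C)) => z /= ->; case: cid => z' /= /clP.
Qed.
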